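(* Let $\mathbf{X}=(X_\lambda,p_{\lambda\lambda'},\Lambda)$ and $\mathbf{Y}=(Y_\mu,q_{\mu\mu'},M)$ be inverse systems in a category $\mathcal{C}$ and let $(f_\mu,\phi),(f'_\mu,\phi'):\mathbf{X}\rightarrow\mathbf{Y}$ be two equivalent morphisms of inverse systems, $(f_\mu,\phi)\sim(f'_\mu,\phi')$. If the morphism $(f_\mu,\phi)$ is uniformly co-movable, then the morphism $(f'_\mu,\phi')$ is also uniformly co-movable.
   Context: An inverse system $\mathbf{X}=(X_\lambda,p_{\lambda\lambda'},\Lambda)$ in a category $\mathcal{C}$ consists of a directed preordered set $\Lambda$, objects $X_\lambda$, and morphisms $p_{\lambda\lambda'}:X_{\lambda'}\to X_\lambda$ for $\lambda\le\lambda'$ with $p_{\lambda\lambda}=1$ and $p_{\lambda\lambda'}\circ p_{\lambda'\lambda''}=p_{\lambda\lambda''}$. All index sets are assumed to be cofinite directed sets (each element has only finitely many predecessors). A morphism of inverse systems $(f_\mu,\phi):\mathbf{X}\to\mathbf{Y}$ consists of a function $\phi:M\to\Lambda$ and morphisms $f_\mu:X_{\phi(\mu)}\to Y_\mu$ such that whenever $\mu\le\mu'$ there is $\lambda\ge\phi(\mu),\phi(\mu')$ with $f_\mu\circ p_{\phi(\mu)\lambda}=q_{\mu\mu'}\circ f_{\mu'}\circ p_{\phi(\mu')\lambda}$. For $\lambda\ge\phi(\mu)$ write $f_{\mu\lambda}:=f_\mu\circ p_{\phi(\mu)\lambda}$. Equivalence: $(f_\mu,\phi)\sim(f'_\mu,\phi')$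 if for every $\mu\in M$ there is $\lambda\ge\phi(\mu),\phi'(\mu)$ with $f_\mu\circ p_{\phi(\mu)\lambda}=f'_\mu\circ p_{\phi'(\mu)\lambda}$. An object $A$ of $\mathcal{C}$ is regarded as the (rudimentary) inverse system indexed by a singleton; thus a morphism $\mathbf{r}:A\to\mathbf{X}$ is a family $r_\lambda:A\to X_\lambda$ with $p_{\lambda\lambda'}\circ r_{\lambda'}=r_\lambda$ for $\lambda\le\lambda'$. $\mathbf{p}_\lambda:\mathbf{X}\to X_\lambda$ is the morphism given by $1_{X_\lambda}$, so $\mathbf{p}_\lambda\circ\mathbf{r}=r_\lambda$. $(f_\mu,\phi)$ is uniformly co-movable if every $\mu\in M$ admits $\lambda\in\Lambda$, $\lambda\ge\phi(\mu)$, and a morphism $\mathbf{r}:X_\lambda\to\mathbf{X}$ with $f_{\mu\lambda}=\mathbf{f}_\mu\circ\mathbf{r}$, where $\mathbf{f}_\mu:=f_\mu\circ\mathbf{p}_{\phi(\mu)}$ (i.e. $f_{\mu\lambda}=f_\mu\circ r_{\phi(\mu)}$). *)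

(* Defs.v *)
From Stdlib Require Import List RelationClasses.

Set Implicit Arguments.
Unset Strict Implicit.
Unset Printing Implicit Defensive.

Record category := Category {
  obj :> Type;
  hom : obj -> obj -> Type;
  idm : forall A, hom A A;
  comp : forall A B D, hom B D -> hom A B -> hom A D;
  comp_idl : forall A B (f : hom A B), comp (idm B) f = f;
  comp_idr : forall A B (f : hom A B), comp f (idm A) = f;
  comp_assoc : forall A B D E (h : hom D E) (g : hom B D) (f : hom A B),
    comp h (comp g f) = comp (comp h g) f
}.

Arguments idm {c} A.

Declare Scope cat_scope.
Delimit Scope cat_scope with cat.
Open Scope cat_scope.

Notation "g \oc f" := (comp g f) (at level 40, left associativity) : cat_scope.

(* Only a preorder: antisymmetry is not required. *)
Record cofinite_directed_set := CofiniteDirectedSet {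
  carrier :> Type;
  le : carrier -> carrier -> Prop;
  le_preorder : PreOrder le;
  directed_inhabited : inhabited carrier;
  directed_ub : forall i j, exists k, le i k /\ le j k;
  cofinite : forall i, exists s : list carrier, forall j, le j i -> In j s
}.

Notation "i <=I j" := (le i j) (at level 70, no associativity) : cat_scope.

(* [bond h] takes a proof h of the inequality. Because [bond_id] and
   [bond_comp] quantify over all such proofs, they force [bond h] not to depend
   on the choice of h (compose with [bond] of a reflexivity proof). *)
Record inverse_system (C : category) := InverseSystem {
  index : cofinite_directed_set;
  term :> index -> C;
  bond : forall i j : index, i <=I j -> hom (term j) (term i);
  bond_id : forall (i : index) (h : i <=I i), bond h = idm (term i);
  bond_comp : forall (i j k : index)
    (hij : i <=I j) (hjk : j <=I k) (hik : i <=I k),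
    bond hij \oc bond hjk = bond hik
}.

Arguments index {C} X : rename.
Arguments bond {C} X {i j} h : rename.

Record system_morphism (C : category) (X Y : inverse_system C) :=
  SystemMorphism {
  index_map : index Y -> index X;
  component :> forall m : index Y, hom (X (index_map m)) (Y m);
  component_compat : forall (m m' : index Y) (hm : m <=I m'),
    exists (l : index X) (h : index_map m <=I l) (h' : index_map m' <=I l),
      component m \oc bond X h = bond Y hm \oc component m' \oc bond X h'
}.

Arguments index_map {C X Y} f m : rename.

(* f_{mu lambda} = f_mu o p_{phi(mu) lambda}, for lambda >= phi(mu) *)
Definition component_at (C : category) (X Y : inverse_system C)
    (f : system_morphism X Y) (m : index Y) (l : index X)
    (h : index_map f m <=I l) : hom (X l) (Y m) :=
  f m \oc bond X h.

Arguments component_at {C X Y} f m {l} h.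

Definition equivalent (C : category) (X Y : inverse_system C)
    (f f' : system_morphism X Y) : Prop :=
  forall m : index Y,
    exists (l : index X) (h : index_map f m <=I l) (h' : index_map f' m <=I l),
      component_at f m h = component_at f' m h'.

(* A morphism from an object A, seen as a system indexed by a singleton, to X:
   since the only bonding morphism of that system is the identity of A, it is
   a compatible family of morphisms out of A. [leg r l] is the composite of r
   with the projection X -> X l. *)
Record object_to_system (C : category) (A : C) (X : inverse_system C) :=
  ObjectToSystem {
  leg :> forall l : index X, hom A (X l);
  leg_compat : forall (l l' : index X) (h : l <=I l'),
    bond X h \oc leg l' = leg l
}.

Definition uniformly_co_movable (C : category) (X Y : inverse_system C)
    (f : system_morphism X Y) : Prop :=
  forall m : index Y,
    exists (l : index X) (h : index_map f m <=I l)
           (r : object_to_system (X l) X),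
      component_at f m h = f m \oc r (index_map f m).

(* Main.v *)
Require Import Defs.
From Stdlib Require Import RelationClasses.

Set Implicit Arguments.
Unset Strict Implicit.
Unset Printing Implicit Defensive.

(** Fix an index m of Y.  The component f m enters uniform co-movability only
    through its restrictions to terms X l far out in X: a family r into X sees
    f m and [component_at f m h] alike ([component_at_leg]), because its legs
    commute with the bonds.  Equivalence says precisely that the restrictions of
    f m and f' m agree at some index l0.  So, if f m factors through
    r : X l -> X at l, choose k above both l and l0 and precompose r with the
    bond X k -> X l: the co-movability equation of f, restricted to k and
    carried over to f' through the common restriction at l0, is the
    co-movability equation of f'. *)

Lemma component_at_bond (C : category) (X Y : inverse_system C)
    (f : system_morphism X Y) (m : index Y) (l k : index X)
    (hl : index_map f m <=I l) (hlk : l <=I k) (hk : index_map f m <=I k) :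
  component_at f m hl \oc bond X hlk = component_at f m hk.
Proof.
unfold component_at.
now rewrite <- comp_assoc, (bond_comp hl hlk hk).
Qed.

(** The composite of f m with a family into X may be computed at any index
    beyond [index_map f m]; this is what allows comparing morphisms whose
    index maps differ. *)
Lemma component_at_leg (C : category) (X Y : inverse_system C)
    (f : system_morphism X Y) (A : C) (r : object_to_system A X)
    (m : index Y) (l : index X) (h : index_map f m <=I l) :
  component_at f m h \oc r l = f m \oc r (index_map f m).
Proof.
unfold component_at.
now rewrite <- comp_assoc, (leg_compat r h).
Qed.

Definition precompose (C : category) (X : inverse_system C) (A B : C)
    (r : object_to_system B X) (g : hom A B) : object_to_system A X.
Proof.
refine (@ObjectToSystem C A X (fun l => r l \oc g) _).
intros l l' h.
now rewrite comp_assoc, (leg_compat r h).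
Defined.

Theorem proposition5p11 (C : category) (X Y : inverse_system C)
    (f f' : system_morphism X Y) (eqv_ff' : equivalent f f')
    (ucm_f : uniformly_co_movable f) :
  uniformly_co_movable f'.
Proof.
intro m.
destruct (ucm_f m) as [l [hl [r Hr]]].
destruct (eqv_ff' m) as [l0 [h0 [h0' H0]]].
destruct (directed_ub l l0) as [k [hlk h0k]].
pose proof (@PreOrder_Transitive _ _ (le_preorder (index X))) as le_trans.
pose proof (le_trans _ _ _ hl hlk) as hk.
pose proof (le_trans _ _ _ h0' h0k) as hk'.
exists k, hk', (precompose r (bond X hlk)).
(* The restrictions agree at l0, hence also at k. *)
rewrite <- (component_at_bond h0' h0k hk'), <- H0,
  (component_at_bond h0 h0k hk).
rewrite <- (component_at_bond hl hlk hk), Hr.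
(* At l0 the composites of f m and f' m with the family r coincide. *)
rewrite <- (component_at_leg r h0), H0, (component_at_leg r h0').
symmetry; apply comp_assoc.
Qed.
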